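(* For all integers $r\geq 2$ and $m,j\geq 0$, we have $$(j+1)\left|\mathcal{O}_{j+1,r}(m)\right|-j\left|\mathcal{O}_{j,r}(m)\right|=\frac{1}{r-1}\cdot\Big(\sum_{\lambda\in\mathcal{O}_{j,r}(m)}\ell(\lambda)-\sum_{\lambda\in\mathcal{D}_{j,r}(m)}\ell(\lambda)\Big),$$ where $\ell(\lambda)$ is the number of parts of $\lambda$ (counted with multiplicity).
   Context: A colored part is a symbol $n_i$ with $n,i$ integers and $1\le i\le n$; $n$ is called its size and $i$ its subscript (or color). Two colored parts $n_i$ and $n'_{i'}$ are equal if and only if $n=n'$ and $i=i'$. An $n$-color partition of a non-negative integer $m$ is a finite multiset of colored parts whose sizes (counted with multiplicity) sum to $m$; the only $n$-color partition of $0$ is the empty one. The multiplicity of a colored part in an $n$-color partition is the number of times it occurs in it. For example, the six $n$-color partitions of $3$ are $(1_1,1_1,1_1)$, $(2_1,1_1)$, $(2_2,1_1)$, $(3_1)$, $(3_2)$, $(3_3)$. For integers $r\ge 2$ and $j,m\ge 0$: - $\mathcal{O}_{j,r}(m)$ is the set of $n$-color partitions of $m$ with exactly $j$ different colored parts (counted without multiplicity; each may be repeated) whose size and subscript are both divisible by $r$. - $\mathcal{D}_{j,r}(m)$ is the set of $n$-color partitions of $m$ with exactly $j$ different colored parts (counted without multiplicity) that occur with multiplicity at least $r$. *)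

(* Defs.v *)
From HB Require Import structures.
From mathcomp Require Import all_boot all_order all_algebra.
From mathcomp Require Import finmap multiset.
From mathcomp Require Import boolp classical_sets functions cardinality fsbigop.

Set Implicit Arguments.
Unset Strict Implicit.
Unset Printing Implicit Defensive.

Local Open Scope classical_set_scope.
Local Open Scope fset_scope.
Local Open Scope mset_scope.
Local Open Scope nat_scope.

(* [ColoredPart (n, i) _] is the colored part n_i. *)
Record colored_part := ColoredPart {
  part_val : nat * nat;
  _ : 0 < part_val.2 <= part_val.1 }.

HB.instance Definition _ := [isSub for part_val].
HB.instance Definition _ := [Countable of colored_part by <:].

Definition part_size (p : colored_part) : nat := (val p).1.
Definition part_color (p : colored_part) : nat := (val p).2.

(* For [l : {mset colored_part}], [l p] is the multiplicity of [p] in [l],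
   [finsupp l] is the set of the different parts of [l], and
   [\sum_(p <- l) _] and [size l] count parts with multiplicity, through the
   coercion of multisets to sequences. *)
Definition ncolor_partitions (m : nat) : set {mset colored_part} :=
  [set l | \sum_(p <- l) part_size p = m].

Definition num_parts (l : {mset colored_part}) : nat := size l.

Definition calO (j r m : nat) : set {mset colored_part} :=
  [set l | ncolor_partitions m l /\
     #|` [fset p in finsupp l | (r %| part_size p) && (r %| part_color p)]| = j].

Definition calD (j r m : nat) : set {mset colored_part} :=
  [set l | ncolor_partitions m l /\
     #|` [fset p in finsupp l | r <= l p]| = j].

(* [fset_set] and [\sum_(_ \in _)] take default values on infinite sets,
   hence the finiteness lemmas. *)
Lemma finite_ncolor_partitions m : finite_set (ncolor_partitions m).
Proof.
pose p0 : colored_part := @ColoredPart (1, 1) isT.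
pose f (x : 'I_m.+1 * 'I_m.+1) : colored_part :=
  insubd p0 (val x.1, val x.2).
pose g (t : m.-bseq ('I_m.+1 * 'I_m.+1)) : {mset colored_part} :=
  seq_mset (map f t).
apply: (@sub_finite_set _ _ (g @` setT)); last first.
  by apply: finite_image; exact: finite_finset.
move=> l /= hl.
have hsz p : p \in enum_mset l -> part_size p <= m.
  by move=> pl; rewrite -hl (big_rem p) //= leq_addr.
have hlen : size l <= m.
  rewrite -[X in _ <= X]hl -sum1_size leq_sum // => p _.
  by have /andP[i0 le_in] := valP p; apply: leq_trans i0 le_in.
pose h (p : colored_part) : 'I_m.+1 * 'I_m.+1 :=
  (inord (part_size p), inord (part_color p)).
have ht : size (map h l) <= m by rewrite size_map.
exists (Bseq ht) => //; rewrite /g /= -map_comp -[RHS]seq_mset_id.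
congr seq_mset; rewrite -[RHS]map_id; apply/eq_in_map => p pl /=.
have := hsz p pl; rewrite /f /h /part_size /part_color => pm.
have pc : (val p).2 <= (val p).1 by have /andP[] := valP p.
apply: val_inj => /=; rewrite !inordK ?ltnS ?(leq_trans pc) //.
by rewrite -surjective_pairing valKd.
Qed.

Lemma finite_calO j r m : finite_set (calO j r m).
Proof. by apply: sub_finite_set (finite_ncolor_partitions m) => l []. Qed.

Lemma finite_calD j r m : finite_set (calD j r m).
Proof. by apply: sub_finite_set (finite_ncolor_partitions m) => l []. Qed.

(* Main.v *)
Require Import Defs.
From HB Require Import structures.
From mathcomp Require Import all_boot all_order all_algebra.
From mathcomp Require Import finmap multiset.
From mathcomp Require Import boolp classical_sets functions cardinality fsbigop.
From mathcomp Require Import qpoly ring.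

(** Both families have a product generating function in which [x] marks the
sum of the sizes, [u] the number of parts and [z] the number of distinguished
different parts (those divisible by [r], respectively those repeated at least
[r] times).  A part of size [n] that is distinguished from [s] copies on
contributes, with [y = u x^n],
<<
  sum_k z^[s <= k] y^k = (1 - (1 - z) y^s) / (1 - y).
>>
Let [N(u)] be the product of [1 - u x^n] over all colored parts, and let
[a(w)] be the product of [1 - w x^(r n)] over all colored parts.  The parts
whose size and color are divisible by [r] are the [r]-fold dilations of all the
parts, so the two generating functions are
<<
  O(u, z) = a((1 - z) u) / N(u)   and   D(u, z) = a((1 - z) u^r) / N(u).
>>
They agree at [u = 1].  Differentiating in [u] at [u = 1] counts parts: the
contributions of [N] cancel in the difference, and the chain rule gives
<<
  O_u - D_u = (1 - r) (1 - z) a'(1 - z) / N(1) = (r - 1) (1 - z) O_z(1, z),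
>>
since [O_z(1, z) = - a'(1 - z) / N(1)].  The coefficient of [z^j x^m] is the
theorem: multiplying [O_z] by [1 - z] produces the combination
[(j + 1) |O_(j+1)| - j |O_j|].

No convergence is involved: only parts of size at most [m] matter, [x] is taken
in a ring where [x^(m+1) = 0], and the multiplicities range over [0, ..., m].
The identities above then hold exactly between polynomials in [z] and [u]
([enumerator_closed], [marks_identity], [parts_identity]).  They are brought
back to counting by reading off the coefficient of [x^m] in [Q[X]/(X^(m+1))]
([truncated_powers], [multiplicities_identity]) and by identifying partitions
of [m] with families of multiplicities ([bij_mset_of]). *)

Set Implicit Arguments.
Unset Strict Implicit.
Unset Printing Implicit Defensive.

Import GRing.Theory Num.Theory.
Local Open Scope fset_scope.
Local Open Scope ring_scope.

(** * Enumerating families of multiplicities *)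

Definition weight (I : finType) (m : nat) (wt : I -> nat)
    (f : {ffun I -> 'I_m.+1}) : nat :=
  (\sum_i f i * wt i)%N.

Definition copies (I : finType) (m : nat) (f : {ffun I -> 'I_m.+1}) : nat :=
  (\sum_i f i)%N.

Definition marks (I : finType) (m : nat) (s : I -> nat)
    (f : {ffun I -> 'I_m.+1}) : nat :=
  (\sum_i (s i <= f i))%N.

(** The outer variable is [u] and the inner one [z]; the weight is carried by a
ring element [x] instead of a variable, so that [x] can be nilpotent.  The
threshold [s i] is the number of copies from which [i] gets marked. *)
Definition enumerator (R : comNzRingType) (x : R) (I : finType) (m : nat)
    (wt s : I -> nat) : {poly {poly R}} :=
  \sum_(f : {ffun I -> 'I_m.+1})
    ((x ^+ weight wt f)%:P * 'X^(marks s f))%:P * 'X^(copies f).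

Lemma enumerator_prod (R : comNzRingType) (x : R) (I : finType) (m : nat)
    (wt s : I -> nat) :
  enumerator x m wt s =
  \prod_(i : I) \sum_(k < m.+1)
    ('X^(s i <= k)%N)%:P * ((x ^+ wt i)%:P%:P * 'X) ^+ k.
Proof.
rewrite bigA_distr_bigA; apply: eq_bigr => f _ /=.
rewrite big_split /= /weight /marks /copies.
under [X in _ = _ * X]eq_bigr => i _ do
  rewrite exprMn -!polyC_exp -exprM mulnC.
rewrite big_split /= -!rmorph_prod /= !prodrXr.
rewrite mulrCA mulrA -rmorphM /=.
by congr (_%:P * _); congr (_ * _); rewrite -rmorph_prod /= prodrXr.
Qed.

(** Multiplying by [1 - y] telescopes: the exponent of [z] jumps only at
[k = s].  When [s > m] there is no jump, and [y ^+ s] vanishes; this is why a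
threshold [m.+1] can stand for never marking. *)
Lemma marked_geometric (K : comNzRingType) (z y : K) (m s : nat) :
  y ^+ m.+1 = 0 -> (0 < s)%N ->
  (1 - y) * (\sum_(k < m.+1) z ^+ (s <= k)%N * y ^+ k) = 1 - (1 - z) * y ^+ s.
Proof.
move=> ym s0.
have partial n : (1 - y) * (\sum_(k < n.+1) z ^+ (s <= k)%N * y ^+ k)
   = 1 - (s <= n)%N%:R * (1 - z) * y ^+ s - z ^+ (s <= n)%N * y ^+ n.+1.
  elim: n => [|n IHn].
    by rewrite big_ord1 leqn0 -[s == 0%N]negbK -lt0n s0 /=; ring.
  rewrite big_ord_recr /= mulrDr IHn [(s <= n.+1)%N]leq_eqVlt ltnS.
  have [->|_] := eqVneq s n.+1; first by rewrite ltnn /= !exprS; ring.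
  by case: (s <= n)%N => /=; rewrite !exprS; ring.
rewrite partial ym mulr0 subr0; have [_|lt_ms] := leqP s m; first by rewrite mul1r.
by rewrite -(subnK lt_ms) exprD ym !mulr0.
Qed.

Lemma nilpotent_Xn (K : nzRingType) (x : K) (m n : nat) :
  x ^+ m.+1 = 0 -> (m < n)%N -> x ^+ n = 0.
Proof. by move=> xm lt_mn; rewrite -(subnK lt_mn) exprD xm mulr0. Qed.

(** Each factor of [enumerator_prod] is a marked geometric sum, and the powers
that the truncation at [m] leaves out vanish. *)
Lemma enumerator_closed (R : comNzRingType) (x : R) (I : finType) (m : nat)
    (wt s : I -> nat) :
  x ^+ m.+1 = 0 -> (forall i, 0 < wt i)%N -> (forall i, 0 < s i)%N ->
  (\prod_i (1 - (x ^+ wt i)%:P%:P * 'X)) * enumerator x m wt s =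
  \prod_i (1 - (1 - 'X)%:P * ((x ^+ wt i)%:P%:P * 'X) ^+ s i).
Proof.
move=> xm wt0 s0; rewrite enumerator_prod -big_split; apply: eq_bigr => i _ /=.
under eq_bigr => k _ do rewrite polyC_exp.
rewrite marked_geometric //; last first.
  rewrite exprMn -!polyC_exp -exprM (nilpotent_Xn xm) ?mul0r //.
  by rewrite ltnNge leqNgt negbK -[X in (X <= _)%N]mul1n leq_mul.
by rewrite rmorphB /= polyC1.
Qed.

Lemma enumerator1 (R : comNzRingType) (x : R) (I : finType) (m : nat)
    (wt s : I -> nat) :
  (enumerator x m wt s).[1] =
  \sum_(f : {ffun I -> 'I_m.+1}) (x ^+ weight wt f)%:P * 'X^(marks s f).
Proof.
rewrite horner_sum; apply: eq_bigr => f _.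
by rewrite hornerM hornerC hornerXn expr1n mulr1.
Qed.

Lemma deriv_enumerator1 (R : comNzRingType) (x : R) (I : finType) (m : nat)
    (wt s : I -> nat) :
  (enumerator x m wt s)^`().[1] =
  \sum_(f : {ffun I -> 'I_m.+1})
    (x ^+ weight wt f *+ copies f)%:P * 'X^(marks s f).
Proof.
rewrite raddf_sum horner_sum; apply: eq_bigr => f _ /=.
rewrite derivM derivC mul0r add0r derivXn hornerM hornerC hornerMn hornerXn.
by rewrite expr1n mulrnAr mulr1 polyCMn mulrnAl.
Qed.

(** A product of terms [1 - nilpotent] is inverted by the product of their
finite geometric series. *)
Lemma prod_sub1_unit (R : comNzRingType) (x : R) (m : nat) (I : finType)
    (wt : I -> nat) : x ^+ m.+1 = 0 -> (forall i, 0 < wt i)%N ->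
  exists v, v * \prod_i (1 - x ^+ wt i) = 1.
Proof.
move=> xm wt0; exists (\prod_i \sum_(k < m.+1) (x ^+ wt i) ^+ k).
rewrite -big_split big1 //= => i _; rewrite mulrC.
have := subrX1 (x ^+ wt i) m.+1.
rewrite -exprM (nilpotent_Xn xm); last first.
  by rewrite -[X in (X <= _)%N]mul1n leq_mul.
by move/(congr1 -%R); rewrite sub0r opprK -mulNr opprB => <-.
Qed.

(** The two enumerators have the same denominator [N], and their numerators
[a((1 - z) u)] and [a((1 - z) u^r)] agree at [u = 1].  Hence the terms where the
derivative in [u] falls on [N] cancel; what remains is a multiple of
[a'(1 - z)], to which the derivative in [z] is proportional too. *)
Lemma marks_identity (R : comNzRingType) (x : R) (m r : nat) (I : finType)
    (wt s1 s2 : I -> nat) (a : {poly R}) :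
  x ^+ m.+1 = 0 -> (forall i, 0 < wt i)%N ->
  (\prod_i (1 - (x ^+ wt i)%:P%:P * 'X)) * enumerator x m wt s1 =
    map_poly polyC a \Po ((1 - 'X)%:P * 'X) ->
  (\prod_i (1 - (x ^+ wt i)%:P%:P * 'X)) * enumerator x m wt s2 =
    map_poly polyC a \Po ((1 - 'X)%:P * 'X^r) ->
  (enumerator x m wt s1)^`().[1] - (enumerator x m wt s2)^`().[1] =
  (r%:R - 1) * ((1 - 'X) * (enumerator x m wt s1).[1]^`()).
Proof.
move=> xm wt0; set N := \prod_i _.
set E1 := enumerator _ _ _ s1; set E2 := enumerator _ _ _ s2 => eq1 eq2.
pose n0 := \prod_i (1 - x ^+ wt i).
have N1 : N.[1] = n0%:P.
  rewrite /N /n0 horner_prod rmorph_prod; apply: eq_bigr => i _.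
  by rewrite !hornerE /= rmorphB rmorph1.
have [v vn0] := prod_sub1_unit xm wt0.
have cancel (p q : {poly R}) : n0%:P * p = n0%:P * q -> p = q.
  move=> /(congr1 ( *%R v%:P)).
  by rewrite !mulrA -rmorphM /= vn0 polyC1 !mul1r.
have val1 : n0%:P * E1.[1] = a \Po (1 - 'X).
  by rewrite -N1 -hornerM eq1 horner_comp !hornerE.
have val2 : n0%:P * E2.[1] = a \Po (1 - 'X).
  by rewrite -N1 -hornerM eq2 horner_comp !hornerE /= expr1n mulr1.
have E12 : E1.[1] = E2.[1] by apply: cancel; rewrite val1 val2.
have dz : n0%:P * E1.[1]^`() = - (a^`() \Po (1 - 'X)).
  have := congr1 (@deriv R) val1.
  rewrite derivM derivC mul0r add0r deriv_comp => ->.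
  by rewrite derivB derivX -polyC1 derivC sub0r mulrN1.
(* The chain rule in [u] at [u = 1], used for [k = 1] and [k = r]. *)
have der (k : nat) (E : {poly {poly R}}) :
    N * E = map_poly polyC a \Po ((1 - 'X)%:P * 'X^k) ->
    N^`().[1] * E.[1] + n0%:P * E^`().[1] =
      (a^`() \Po (1 - 'X)) * (k%:R * (1 - 'X)).
  move=> eqE; rewrite -N1 -!hornerM -hornerD -derivM eqE deriv_comp.
  rewrite hornerM horner_comp deriv_map !(hornerM, hornerC, hornerXn) expr1n mulr1.
  congr (_ * _).
  rewrite derivM derivC mul0r add0r derivXn hornerM hornerC hornerMn hornerXn.
  by rewrite expr1n mulrC.
have d1 := der 1%N E1 eq1; have d2 := der r E2 eq2.
apply: cancel; rewrite mulrBr.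
(* Adding and subtracting the common term in [N^`()] makes both sides of
   [der] appear. *)
have -> : n0%:P * E1^`().[1] - n0%:P * E2^`().[1] =
   (N^`().[1] * E1.[1] + n0%:P * E1^`().[1])
   - (N^`().[1] * E2.[1] + n0%:P * E2^`().[1]) by rewrite E12; ring.
rewrite d1 d2; set q := a^`() \Po _ in dz *.
have -> : q = - (n0%:P * E1.[1]^`()) by rewrite dz opprK.
by ring.
Qed.

(** * Colored parts and their dilations *)

Definition parts_upto (m : nat) : {fset colored_part} :=
  [fset p in pmap insub [seq (n, i) | n <- iota 0 m.+1, i <- iota 0 m.+1]].

Lemma part_size_gt0 (p : colored_part) : (0 < part_size p)%N.
Proof. by have /andP[i0 le_in] := valP p; apply: leq_trans i0 le_in. Qed.

Lemma in_parts_upto (m : nat) (p : colored_part) :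
  (p \in parts_upto m) = (part_size p <= m)%N.
Proof.
have le_color : (part_color p <= part_size p)%N by have /andP[] := valP p.
rewrite !inE mem_pmap_sub; apply/allpairsP/idP.
  by case=> -[n i] [+ _ eq_p]; rewrite mem_iota /part_size [\val p]eq_p ltnS.
move=> le_pm; exists (part_size p, part_color p).
rewrite !mem_iota /= !add0n !ltnS le_pm (leq_trans le_color le_pm).
by split=> //; rewrite -surjective_pairing.
Qed.

Definition multiple_part (r : nat) (p : colored_part) : bool :=
  ((r %| part_size p) && (r %| part_color p))%N.

Definition scale_part (r : nat) (p : colored_part) : colored_part :=
  insubd p (r * part_size p, r * part_color p)%N.

Lemma val_scale_part (r : nat) (p : colored_part) : (0 < r)%N ->
  val (scale_part r p) = (r * part_size p, r * part_color p)%N.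
Proof.
move=> r0; rewrite insubdK // /in_mem /= muln_gt0 r0 leq_pmul2l //.
by have /andP[-> ->] := valP p.
Qed.

(** Dilation by [r] is a bijection from the parts of size at most [m / r] onto
the multiple parts of size at most [m]; the other parts on the right have
[r * part_size p > m] and contribute [1]. *)
Lemma prod_multiple_parts (C : comNzRingType) (G : nat -> C) (r m : nat) :
  (0 < r)%N -> (forall n, (m < n)%N -> G n = 1) ->
  \prod_(p <- parts_upto m | multiple_part r p) G (part_size p) =
  \prod_(p <- parts_upto m) G (r * part_size p)%N.
Proof.
move=> r0 G1.
rewrite [RHS](bigID (fun p => r * part_size p <= m)%N) /= [X in _ * X]big1
  ?mulr1; last first.
  by move=> p; rewrite -ltnNge => /G1.
rewrite -big_filter -[RHS]big_filter.
have sizeE p : (r * part_size p)%N = part_size (scale_part r p).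
  by rewrite /part_size val_scale_part.
under [RHS]eq_bigr => p _ do rewrite sizeE.
rewrite -[RHS](big_map (scale_part r) xpredT (fun p => G (part_size p))).
apply: perm_big; apply: uniq_perm; rewrite ?filter_uniq ?fset_uniq //.
  rewrite map_inj_uniq ?filter_uniq ?fset_uniq // => p q /(congr1 val).
  rewrite !val_scale_part // => -[] /eqP + /eqP.
  rewrite !eqn_pmul2l // => /eqP eq_size /eqP eq_color.
  by apply: val_inj; rewrite [LHS]surjective_pairing [RHS]surjective_pairing; congr pair.
move=> q; rewrite mem_filter in_parts_upto; apply/andP/mapP.
  case=> /andP[/dvdnP[n nE] /dvdnP[i iE]] le_qm.
  have in_val : (0 < (n, i).2 <= (n, i).1)%N.
    have := valP q; rewrite -[(val q).1]/(part_size q) -[(val q).2]/(part_color q).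
    by rewrite nE iE muln_gt0 r0 andbT leq_pmul2r.
  exists (ColoredPart in_val).
    rewrite mem_filter in_parts_upto /part_size /= mulnC -nE le_qm /=.
    by rewrite (leq_trans _ le_qm) // nE leq_pmulr.
  apply: val_inj; rewrite val_scale_part // /part_size /part_color /=.
  by rewrite ![(r * _)%N]mulnC -nE -iE -surjective_pairing.
case=> p; rewrite mem_filter => /andP[le_rp _] ->.
by rewrite /multiple_part -sizeE /part_color val_scale_part //= !dvdn_mulr.
Qed.

(** The multiplicities used below never reach [m.+1], so this value leaves a
part unmarked. *)
Definition multiple_threshold (r m : nat) (p : colored_part) : nat :=
  if multiple_part r p then 1%N else m.+1.

(** Both numerators come from [a(w)], the product of the [1 - w x^(r n)]: for
the threshold [r] by raising [u x^n] to the power [r], for [multiple_threshold]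
by replacing the multiple parts by the dilations of all parts. *)
Lemma parts_identity (R : comNzRingType) (x : R) (m r : nat) :
  x ^+ m.+1 = 0 -> (0 < r)%N ->
  let E s := enumerator x m (fun p : parts_upto m => part_size (val p))
                            (fun p => s (val p)) in
  (E (multiple_threshold r m))^`().[1] - (E (fun=> r))^`().[1] =
  (r%:R - 1) * ((1 - 'X) * (E (multiple_threshold r m)).[1]^`()).
Proof.
move=> xm r0 E.
have size0 (p : parts_upto m) : (0 < part_size (val p))%N by apply: part_size_gt0.
pose a := \prod_(p <- parts_upto m) (1 - (x ^+ (r * part_size p))%:P * 'X).
have aE (k : nat) : map_poly polyC a \Po ((1 - 'X)%:P * 'X^k) =
    \prod_(p <- parts_upto m)
      (1 - (1 - 'X)%:P * ((x ^+ (r * part_size p))%:P%:P * 'X^k)).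
  rewrite /a !rmorph_prod; apply: eq_bigr => p _.
  rewrite !rmorphB !rmorph1 !rmorphM /= map_polyC map_polyX /=.
  by rewrite comp_polyC comp_polyX mulrCA.
apply: (@marks_identity _ x m r _ _ _ _ a) => //.
  rewrite enumerator_closed // => [|p]; last by rewrite /multiple_threshold; case: ifP.
  rewrite -[X in _ * X]expr1 aE.
  pose G n := 1 - (1 - 'X : {poly R})%:P * ((x ^+ n)%:P%:P * 'X).
  rewrite -(prod_multiple_parts (G := G)) //; last first.
    by move=> n /(nilpotent_Xn xm) xn0; rewrite /G xn0 mul0r mulr0 subr0.
  rewrite [RHS]big_mkcond [RHS]big_seq_fsetE; apply: eq_bigr => p _.
  rewrite /multiple_threshold /G; case: ifP => // _.
  rewrite exprMn -!polyC_exp -exprM (nilpotent_Xn xm) ?mul0r ?mulr0 ?subr0 //.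
  by rewrite -[X in (X <= _)%N]mul1n leq_mul.
rewrite enumerator_closed // aE [RHS]big_seq_fsetE; apply: eq_bigr => p _.
by rewrite exprMn -!polyC_exp -exprM mulnC.
Qed.

(** * Extracting coefficients *)

Lemma coef_sum_marks (R : nzRingType) (T : finType) (c : T -> R)
    (d : T -> nat) (j : nat) :
  (\sum_f (c f)%:P * 'X^(d f))`_j = \sum_(f | d f == j) c f.
Proof.
rewrite coef_sum [RHS]big_mkcond; apply: eq_bigr => f _.
by rewrite coefCM coefXn eq_sym; case: eqP; rewrite ?mulr1 ?mulr0.
Qed.

Lemma coef_one_minus_X_deriv (R : nzRingType) (p : {poly R}) (j : nat) :
  ((1 - 'X) * p^`())`_j = p`_j.+1 *+ j.+1 - p`_j *+ j.
Proof.
by rewrite mulrBl mul1r coefB coefXM !coef_deriv; case: j.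
Qed.

(** A part of a partition of [m] occurs at most [m] times, which makes this a
finite type containing all the partitions of [m]. *)
Definition multiplicities (m : nat) := {ffun parts_upto m -> 'I_m.+1}.

Definition total_size (m : nat) (f : multiplicities m) : nat :=
  weight (fun p => part_size (val p)) f.

Definition num_multiple (r m : nat) (f : multiplicities m) : nat :=
  marks (fun p => multiple_threshold r m (val p)) f.

Definition num_frequent (r m : nat) (f : multiplicities m) : nat :=
  marks (fun=> r) f.

Lemma parts_identity_coef (R : comNzRingType) (x : R) (m r j : nat) :
  x ^+ m.+1 = 0 -> (0 < r)%N ->
  \sum_(f : multiplicities m | num_multiple r f == j) x ^+ total_size f *+ copies f
    - \sum_(f : multiplicities m | num_frequent r f == j) x ^+ total_size f *+ copies f =
  (r%:R - 1) *
    ((\sum_(f : multiplicities m | num_multiple r f == j.+1)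
        x ^+ total_size f) *+ j.+1
     - (\sum_(f : multiplicities m | num_multiple r f == j)
          x ^+ total_size f) *+ j).
Proof.
move=> xm r0; have := congr1 (fun p : {poly R} => p`_j) (parts_identity xm r0).
rewrite !deriv_enumerator1 enumerator1 coefB.
rewrite -(rmorph_nat polyC) -(rmorph1 polyC) -rmorphB coefCM rmorph1.
by rewrite coef_one_minus_X_deriv !coef_sum_marks.
Qed.

(** The ring is [Q[X]/(X^(m+1))] and [phi] reads the coefficient of [X^m]. *)
Lemma truncated_powers (m : nat) :
  exists (R : comNzRingType) (x : R) (phi : {additive R -> rat}),
    x ^+ m.+1 = 0 /\ forall k, phi (x ^+ k) = (k == m)%:R.
Proof.
pose h : {poly rat} := 'X^(m.+1).
have mk : mk_monic h = 'X^(m.+1) by rewrite mk_monic_Xn.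
pose phi (q : {poly %/ h}) : rat := (val q)`_m.
have phiA : zmod_morphism phi by move=> u v; rewrite /phi /= coefB.
pose Phi : {additive {poly %/ h} -> rat} :=
  HB.pack phi (GRing.isZmodMorphism.Build _ _ phi phiA).
have xm : (in_qpoly h 'X) ^+ m.+1 = 0.
  rewrite -rmorphXn; apply: val_inj => /=.
  by rewrite mk Pdiv.RingMonic.rmodpp ?monicXn.
exists {poly %/ h}, (in_qpoly h 'X), Phi; split=> // k.
have [le_km | lt_mk] := leqP k m; last first.
  by rewrite (nilpotent_Xn xm lt_mk) raddf0 gtn_eqF.
rewrite -rmorphXn -[LHS]/((in_qpoly h 'X^k)`_m) in_qpoly_small.
  by rewrite coefXn eq_sym.
by rewrite mk !size_polyXn !ltnS.
Qed.

Lemma multiplicities_identity (m r j : nat) : (0 < r)%N ->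
  \sum_(f : multiplicities m |
        (total_size f == m) && (num_multiple r f == j)) (copies f)%:R
    - \sum_(f : multiplicities m |
        (total_size f == m) && (num_frequent r f == j)) (copies f)%:R =
  (r%:R - 1) *
    ((\sum_(f : multiplicities m |
        (total_size f == m) && (num_multiple r f == j.+1)) 1) *+ j.+1
     - (\sum_(f : multiplicities m |
        (total_size f == m) && (num_multiple r f == j)) 1) *+ j) :> rat.
Proof.
move=> r0; have [R [x [phi [xm phiX]]]] := truncated_powers m.
have phiS (P : pred (multiplicities m)) (n : multiplicities m -> nat) :
    phi (\sum_(f | P f) x ^+ total_size f *+ n f) =
    \sum_(f | (total_size f == m) && P f) (n f)%:R.
  rewrite raddf_sum [LHS]big_mkcond [RHS]big_mkcond; apply: eq_bigr => f _.
  rewrite raddfMn /= phiX andbC; case: (P f) => //=.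
  by case: (_ == m) => //=; rewrite mul0rn.
have := congr1 phi (parts_identity_coef j xm r0).
rewrite mulrBl mul1r mulr_natl !(raddfB, raddfMn).
have phi1 (P : pred (multiplicities m)) :
    phi (\sum_(f | P f) x ^+ total_size f) = \sum_(f | (total_size f == m) && P f) 1.
  by have := phiS P (fun=> 1%N); under eq_bigr => f _ do rewrite mulr1n.
by rewrite !phiS !phi1 => ->; rewrite mulrBl mul1r mulr_natl.
Qed.

(** * Partitions as families of multiplicities *)

Definition mset_of (m : nat) (f : multiplicities m) : {mset colored_part}%mset :=
  [fsfun p : parts_upto m => f p : nat].

Lemma mset_of_in (m : nat) (f : multiplicities m) (p : parts_upto m) :
  mset_of f (val p) = f p.
Proof. by rewrite /mset_of fsfun_ffun valK. Qed.

Lemma mset_of_out (m : nat) (f : multiplicities m) (p : colored_part) :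
  p \notin parts_upto m -> mset_of f p = 0%N.
Proof. by move=> notp; rewrite /mset_of fsfun_ffun insubF //; apply/negbTE. Qed.

Lemma sum_finsupp_mset_of (m : nat) (f : multiplicities m) (F : colored_part -> nat) :
  (forall p, mset_of f p = 0 -> F p = 0)%N ->
  (\sum_(p <- finsupp (mset_of f)) F p = \sum_(p : parts_upto m) F (val p))%N.
Proof.
move=> F0; rewrite -(big_seq_fsetE _ (parts_upto m) xpredT F) /=.
apply: big_fset_incl; first exact: finsupp_sub.
by move=> p _; rewrite memNfinsupp => /eqP; apply: F0.
Qed.

Lemma sum_mset_of (m : nat) (f : multiplicities m) :
  (\sum_(p <- mset_of f) part_size p = total_size f)%N.
Proof.
rewrite sum_mset sum_finsupp_mset_of => [|p -> //].
by apply: eq_bigr => p _; rewrite mset_of_in.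
Qed.

Lemma num_parts_mset_of (m : nat) (f : multiplicities m) :
  num_parts (mset_of f) = copies f.
Proof.
rewrite /num_parts -sum1_size sum_mset sum_finsupp_mset_of => [|p -> //].
by apply: eq_bigr => p _; rewrite mset_of_in muln1.
Qed.

Lemma card_filter_mset_of (m : nat) (f : multiplicities m) (P : pred colored_part) :
  #|` [fset p in finsupp (mset_of f) | P p]| =
  (\sum_(p : parts_upto m) ((0 < f p) && P (val p)))%N.
Proof.
transitivity (\sum_(p <- finsupp (mset_of f)) ((0 < mset_of f p) && P p))%N.
  rewrite card_fset_sum1 -big_fset_condE big_mkcond /=.
  apply: eq_big_seq => p; rewrite mem_finsupp -lt0n => -> /=.
  by case: (P p).
rewrite sum_finsupp_mset_of => [|p -> //].
by apply: eq_bigr => p _; rewrite mset_of_in.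
Qed.

Lemma card_multiple_mset_of (r m : nat) (f : multiplicities m) :
  #|` [fset p in finsupp (mset_of f) | ((r %| part_size p) && (r %| part_color p))%N]|
    = num_multiple r f.
Proof.
rewrite (card_filter_mset_of f (multiple_part r)); apply: eq_bigr => p _.
rewrite /multiple_threshold; case: ifP => _; first by rewrite andbT.
by rewrite andbF leqNgt ltn_ord.
Qed.

Lemma card_frequent_mset_of (r m : nat) (f : multiplicities m) : (0 < r)%N ->
  #|` [fset p in finsupp (mset_of f) | (r <= mset_of f p)%N]| = num_frequent r f.
Proof.
move=> r0; rewrite (card_filter_mset_of f (fun p => (r <= mset_of f p)%N)).
apply: eq_bigr => p _; rewrite mset_of_in andb_idl //; exact: leq_trans.
Qed.

(** Only surjectivity has content: in a partition of [m], the product of the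
size and of the multiplicity of a part is at most [m], so both fit the bounds
of [multiplicities]. *)
Lemma bij_mset_of (m : nat) (d : {mset colored_part}%mset -> nat)
    (e : multiplicities m -> nat) (j : nat) :
  (forall f, d (mset_of f) = e f) ->
  set_bij [set` [pred f : multiplicities m | (total_size f == m) && (e f == j)]]%classic
    [set l | ncolor_partitions m l /\ d l = j]%classic (@mset_of m).
Proof.
move=> de; split.
- by move=> f /andP[/eqP fm /eqP fj]; split; rewrite ?de // /ncolor_partitions /= sum_mset_of.
- move=> f g _ _ eq_fg; apply/ffunP => p; apply: val_inj.
  by rewrite /= -!mset_of_in eq_fg.
move=> l [lm lj].
have l_size p : p \in l -> (l p * part_size p <= m)%N.
  rewrite -msuppE => pl; rewrite -lm sum_mset.
  by rewrite (big_fsetD1 p) //= leq_addr.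
have l_le p : (l p <= m)%N.
  have [pl | /mset_eq0P -> //] := boolP (p \in l).
  by apply: leq_trans (l_size p pl); rewrite leq_pmulr // part_size_gt0.
pose f : multiplicities m := [ffun p => inord (l (val p))].
have fl : mset_of f = l.
  apply/msetP => p; have [pm | notp] := boolP (p \in parts_upto m).
    by rewrite -[p]/(val [` pm]) mset_of_in ffunE inordK // ltnS.
  rewrite mset_of_out //; apply/esym/mset_eq0P; apply: contra notp => pl.
  rewrite in_parts_upto; apply: leq_trans (l_size p pl).
  by rewrite leq_pmull // mset_gt0.
by exists f => //; apply/andP; split; rewrite -?de -?sum_mset_of fl ?lj ?lm ?eqxx.
Qed.

(** The statistic [d] is arbitrary so that both families are instances. *)
Lemma fsum_mset_of (m : nat) (d : {mset colored_part}%mset -> nat)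
    (e : multiplicities m -> nat) (j : nat) (F : {mset colored_part}%mset -> rat) :
  (forall f, d (mset_of f) = e f) ->
  \sum_(l \in [set l | ncolor_partitions m l /\ d l = j]%classic) F l =
  \sum_(f : multiplicities m | (total_size f == m) && (e f == j)) F (mset_of f).
Proof.
move=> de; rewrite [RHS]bigfs ?index_enum_uniq // => [|f]; last first.
  by rewrite mem_index_enum.
exact: (reindex_fsbig _ _ _ F (bij_mset_of j de)).
Qed.

Lemma fsum_calO (j r m : nat) (F : {mset colored_part}%mset -> rat) :
  \sum_(l \in calO j r m) F l =
  \sum_(f : multiplicities m |
        (total_size f == m) && (num_multiple r f == j)) F (mset_of f).
Proof. exact: fsum_mset_of (card_multiple_mset_of r (m := m)). Qed.

Lemma fsum_calD (j r m : nat) (F : {mset colored_part}%mset -> rat) : (0 < r)%N ->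
  \sum_(l \in calD j r m) F l =
  \sum_(f : multiplicities m |
        (total_size f == m) && (num_frequent r f == j)) F (mset_of f).
Proof.
move=> r0.
by apply: (fsum_mset_of (d := fun l => #|` [fset p in finsupp l | (r <= l p)%N]|))
  => f; apply: card_frequent_mset_of.
Qed.

Lemma card_calO (j r m : nat) :
  #|` fset_set (calO j r m)|%:R =
  \sum_(f : multiplicities m |
        (total_size f == m) && (num_multiple r f == j)) 1 :> rat.
Proof.
rewrite -(fsum_calO j r m (fun=> 1)) fsbig_finite; last exact: finite_calO.
by rewrite card_fset_sum1 natr_sum.
Qed.

Theorem theorem3p1 (r m j : nat) (hr : (2 <= r)%N) :
  (j + 1)%N%:R * #|` fset_set (calO (j + 1) r m)|%:R
    - j%:R * #|` fset_set (calO j r m)|%:R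
  = 1 / (r%:R - 1) *
    (\sum_(l \in calO j r m) ((num_parts l)%:R : rat)
     - \sum_(l \in calD j r m) ((num_parts l)%:R : rat)) :> rat.
Proof.
have r0 : (0 < r)%N by apply: ltnW.
have r1 : r%:R - 1 != 0 :> rat by rewrite subr_eq0 pnatr_eq1 gtn_eqF.
rewrite !card_calO fsum_calO fsum_calD //.
under [X in _ * (X - _)]eq_bigr => f _ do rewrite num_parts_mset_of.
under [X in _ * (_ - X)]eq_bigr => f _ do rewrite num_parts_mset_of.
rewrite multiplicities_identity // mul1r mulKf //.
by rewrite addn1 !mulr_natl.
Qed.
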